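(* Let $c$ be the E-Capra coupling on $\mathbb{R}^d\times\mathbb{R}^d$, defined by $c(x,y)=\langle x,y\rangle/\|x\|$ if $x\neq 0$ and $c(0,y)=0$, and let $n:\mathbb{R}^d\to\mathbb{R}^d$ be the normalization mapping $n(x)=x/\|x\|$ if $x\neq 0$, $n(0)=0$. A function on $\mathbb{R}^d$ is $c$-convex if and only if it is the composition of a closed convex function on $\mathbb{R}^d$ with the normalization mapping $n$. More precisely, for any function $h:\mathbb{R}^d\to\overline{\mathbb{R}}$ the following are equivalent: (a) $h$ is $c$-convex; (b) $h=h^{cc'}$; (c) $h=(h^{c})^{\star'}\circ n$ (where $(h^{c})^{\star'}:\mathbb{R}^d\to\overline{\mathbb{R}}$ is a closed convex function); (d) there exists a closed convex function $f:\mathbb{R}^d\to\overline{\mathbb{R}}$ such that $h=f\circ n$.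
   Context: $d\geq 1$ is an integer; $\mathbb{R}^d$ carries the scalar product $\langle\cdot,\cdot\rangle$ and the Euclidean norm $\|\cdot\|$; $\overline{\mathbb{R}}=[-\infty,+\infty]$. A function is convex if its epigraph is convex, and closed if it is either lower semicontinuous and nowhere equal to $-\infty$, or is the constant function $-\infty$. For $g:\mathbb{R}^d\to\overline{\mathbb{R}}$, $g^{\star'}(x)=\sup_{y\in\mathbb{R}^d}(\langle x,y\rangle-g(y))$ is the (reverse) Fenchel conjugate. For $h,g:\mathbb{R}^d\to\overline{\mathbb{R}}$: $h^{c}(y)=\sup_{x\in\mathbb{R}^d}(c(x,y)-h(x))$, $g^{c'}(x)=\sup_{y\in\mathbb{R}^d}(c(x,y)-g(y))$, $h^{cc'}=(h^c)^{c'}$. By definition $h$ is $c$-convex if it equals its $c$-biconjugate $h^{cc'}$. *)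

(* Defs.v *)
From mathcomp Require Import all_boot all_order all_algebra.
From mathcomp Require Import all_classical all_reals all_analysis.
Import Order.TTheory GRing.Theory Num.Theory.
Import numFieldNormedType.Exports.

Set Implicit Arguments.
Unset Strict Implicit.
Unset Printing Implicit Defensive.

Local Open Scope classical_set_scope.
Local Open Scope ring_scope.

Definition dot (R : realType) (d : nat) (x y : 'rV[R]_d) : R :=
  \sum_(i < d) x 0 i * y 0 i.

(* The library norm `|x| on 'rV[R]_d is the sup norm, hence a separate
   Euclidean norm. Both induce the topology that 'rV[R]_d carries in the
   library, so [lower_semicontinuous] below has its usual meaning. *)
Definition enorm (R : realType) (d : nat) (x : 'rV[R]_d) : R :=
  Num.sqrt (dot x x).

Definition normalization (R : realType) (d : nat) (x : 'rV[R]_d) : 'rV[R]_d :=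
  if x == 0 then 0 else (enorm x)^-1 *: x.

Definition ecapra (R : realType) (d : nat) (x y : 'rV[R]_d) : R :=
  if x == 0 then 0 else dot x y / enorm x.

(* Couplings are real-valued, so the differences below never have the
   form +oo - +oo. *)
Definition conjugate (R : realType) (U V : Type) (c : U -> V -> R)
    (h : U -> \bar R) (y : V) : \bar R :=
  ereal_sup [set ((c x y)%:E - h x)%E | x in [set: U]].

Definition rev_conjugate (R : realType) (U V : Type) (c : U -> V -> R)
    (g : V -> \bar R) (x : U) : \bar R :=
  ereal_sup [set ((c x y)%:E - g y)%E | y in [set: V]].

Definition biconjugate (R : realType) (U V : Type) (c : U -> V -> R)
    (h : U -> \bar R) : U -> \bar R :=
  rev_conjugate c (conjugate c h).

Definition coupling_convex (R : realType) (U V : Type) (c : U -> V -> R)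
    (h : U -> \bar R) : Prop :=
  h = biconjugate c h.

Definition rev_fenchel (R : realType) (d : nat) (g : 'rV[R]_d -> \bar R) :
    'rV[R]_d -> \bar R :=
  rev_conjugate (@dot R d) g.

(* R^o is R seen as a vector space over itself. *)
Definition epigraph (R : realType) (d : nat) (f : 'rV[R]_d -> \bar R) :
    set (convex_lmodType ('rV[R]_d * R^o)%type) :=
  [set p | (f p.1 <= (p.2 : R)%:E)%E].

Definition convex_fun (R : realType) (d : nat) (f : 'rV[R]_d -> \bar R) : Prop :=
  convex_set (epigraph f).

Definition closed_fun (R : realType) (d : nat) (f : 'rV[R]_d -> \bar R) : Prop :=
  (lower_semicontinuous f /\ forall x, f x <> -oo%E) \/ f = cst -oo%E.

Definition closed_convex (R : realType) (d : nat) (f : 'rV[R]_d -> \bar R) : Prop :=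
  closed_fun f /\ convex_fun f.

(* Main.v *)
(** Since c(x, y) = <n(x), y>, the reverse c-conjugate of g is g^{*'} o n, and the
    c-biconjugate never exceeds h. Conversely, if h = f o n with f closed convex,
    then h^c <= f^*, so that h^{cc'} >= f^{**'} o n = f o n = h by the
    Fenchel-Moreau theorem, which is obtained by projecting points lying below
    the graph of f onto the epigraph of f in R^d x R. *)
Require Import Defs.
From mathcomp Require Import all_boot all_order all_algebra.
From mathcomp Require Import all_classical all_reals all_analysis.
From mathcomp Require Import ring lra.
Import Order.TTheory GRing.Theory Num.Theory.
Import numFieldNormedType.Exports.

Set Implicit Arguments.
Unset Strict Implicit.
Unset Printing Implicit Defensive.

Local Open Scope classical_set_scope.
Local Open Scope ring_scope.

(** * Conjugacy for an arbitrary real-valued coupling *)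

Section Conjugates.
Context {R : realType}.
Implicit Types (a b : R) (u v w : \bar R).
Local Open Scope ereal_scope.

Lemma lee_fin_subC a u v : a%:E - u <= v -> a%:E - v <= u.
Proof.
by case: u v => [u||] [v||]//=; rewrite ?leNye ?leey// !lee_fin; lra.
Qed.

(** Reduces Fenchel-Moreau to real heights strictly below the graph, the value [+oo] included. *)
Lemma leeP_lt_fin u v : (forall a, a%:E < u -> a%:E <= v) -> u <= v.
Proof.
case: u => [u||] H; last by rewrite leNye.
  apply/lee_addgt0Pr => e e0; rewrite -leeBlDr//.
  by apply: H; rewrite lte_fin gtrBl.
case: v H => [v||] H //; last by have := H 0%R (ltry _).
by have := H (v + 1)%R (ltry _); rewrite lee_fin gerDl ler10.
Qed.

Context {U V : Type} (c : U -> V -> R).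

Lemma conjugate_ubound (h : U -> \bar R) x y :
  (c x y)%:E - h x <= conjugate c h y.
Proof. by apply: ereal_sup_ubound; exists x. Qed.

Lemma rev_conjugate_ubound (g : V -> \bar R) x y :
  (c x y)%:E - g y <= rev_conjugate c g x.
Proof. by apply: ereal_sup_ubound; exists y. Qed.

Lemma conjugate_le (h : U -> \bar R) y u :
  (forall x, (c x y)%:E - h x <= u) -> conjugate c h y <= u.
Proof. by move=> H; apply: ge_ereal_sup => _ [x _ <-]. Qed.

Lemma rev_conjugateP (g : V -> \bar R) x u :
  (rev_conjugate c g x <= u) <-> (forall y, (c x y)%:E - g y <= u).
Proof.
split=> [H y|H]; first exact: le_trans (rev_conjugate_ubound _ _ _) H.
by apply: ge_ereal_sup => _ [y _ <-].
Qed.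

Lemma biconjugate_le (h : U -> \bar R) x : biconjugate c h x <= h x.
Proof.
by apply/rev_conjugateP => y; apply: lee_fin_subC; exact: conjugate_ubound.
Qed.

Lemma le_rev_conjugate (g1 g2 : V -> \bar R) x :
  (forall y, g2 y <= g1 y) -> rev_conjugate c g1 x <= rev_conjugate c g2 x.
Proof.
move=> g21; apply/rev_conjugateP => y.
by apply: le_trans (rev_conjugate_ubound g2 x y); exact: leeB.
Qed.

End Conjugates.

Lemma convex_setP (R : numDomainType) (M : lmodType R)
    (A : set (convex_lmodType M)) :
  convex_set A <-> forall (x y : M) (t : R), 0 <= t -> t <= 1 ->
    A x -> A y -> A (t *: x + (1 - t) *: y).
Proof.
split=> [cA x y t t0 t1 Ax Ay|cA x y t].
  by have := cA x y (Itv01 t0 t1); rewrite !inE; exact.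
by rewrite !inE => Ax Ay; exact: (cA x y t%:num).
Qed.

(** * The Euclidean scalar product *)

Section Dot.
Context {R : realType} {d : nat}.
Implicit Types x y z : 'rV[R]_d.

Lemma dotC x y : dot x y = dot y x.
Proof. by apply: eq_bigr => i _; rewrite mulrC. Qed.

Lemma dotDl x y z : dot (x + y) z = dot x z + dot y z.
Proof. by rewrite -big_split; apply: eq_bigr => i _; rewrite !mxE mulrDl. Qed.

Lemma dotZl a x y : dot (a *: x) y = a * dot x y.
Proof. by rewrite /dot mulr_sumr; apply: eq_bigr => i _; rewrite !mxE mulrA. Qed.

Lemma dot0r x : dot x 0 = 0.
Proof. by rewrite dotC -(scale0r 0) dotZl mul0r. Qed.

Lemma dotBl x y z : dot (x - y) z = dot x z - dot y z.
Proof. by rewrite dotDl -scaleN1r dotZl mulN1r. Qed.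

Lemma sqr_dotZB t x y :
  dot (t *: x - y) (t *: x - y) =
  t ^+ 2 * dot x x - t * dot y x *+ 2 + dot y y.
Proof.
rewrite dotBl dotZl !(dotC _ (_ - _)) !dotBl !dotZl (dotC x y); ring.
Qed.

Lemma dotN x : dot (- x) (- x) = dot x x.
Proof. by apply: eq_bigr => i _; rewrite !mxE mulrNN. Qed.

Lemma dot_ge0 x : 0 <= dot x x.
Proof. by apply: sumr_ge0 => i _; rewrite -expr2 sqr_ge0. Qed.

Lemma sqr_coord_le_dot x i : x 0 i ^+ 2 <= dot x x.
Proof.
rewrite /dot (bigD1 i)//= -expr2 lerDl.
by apply: sumr_ge0 => j _; rewrite -expr2 sqr_ge0.
Qed.

Lemma dot_eq0 x : dot x x = 0 -> x = 0.
Proof.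
move=> x0; apply/rowP => i; rewrite mxE; apply/eqP.
by rewrite -sqrf_eq0 eq_le sqr_ge0 andbT -x0 sqr_coord_le_dot.
Qed.

Lemma cvg_dot (T : Type) (F : set_system T) (FF : Filter F)
    (f g : T -> 'rV[R]_d) x y :
  f @ F --> x -> g @ F --> y -> (fun t => dot (f t) (g t)) @ F --> dot x y.
Proof.
move=> fx gy; apply: (@cvg_big R^o) => [|i _]; first exact: add_continuous.
apply: cvgM.
  exact: (cvg_comp _ _ fx (@coord_continuous _ _ _ _ _ _)).
exact: (cvg_comp _ _ gy (@coord_continuous _ _ _ _ _ _)).
Qed.

Lemma continuous_dotl y : continuous (fun x => dot x y).
Proof. move=> x.
exact: (@cvg_dot _ (nbhs x) _ id (cst y) _ _ cvg_id (cvg_cst y)). Qed.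

End Dot.

(** * Reverse Fenchel conjugates are closed convex *)

Section ClosedConvexConjugate.
Context {R : realType} {d : nat} (g : 'rV[R]_d -> \bar R).

(** A strict superlevel set of a supremum is the union of those of its terms; each is an open
    half-space, empty or everything, according to [g y]. *)
Lemma lower_semicontinuous_rev_fenchel :
  lower_semicontinuous (rev_fenchel g).
Proof.
apply/lower_semicontinuousP => a.
have -> : [set x | (a%:E < rev_fenchel g x)%E] =
    \bigcup_y [set x | (a%:E < (dot x y)%:E - g y)%E].
  apply/seteqP; split=> [x|x [y _]] /=.
    by move/ereal_sup_gt => [_ [y _ <-] ?]; exists y.
  by move/lt_le_trans; apply; exact: rev_conjugate_ubound.
apply: bigcup_open => y _; case: (g y) => [b||] /=.
- rewrite (_ : mkset _ = (fun x => dot x y) @^-1` [set r | a + b < r]).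
    by apply: open_comp => [x _|]; [exact: continuous_dotl|exact: open_gt].
  by apply/seteqP; split=> x /=; rewrite -EFinB lte_fin ltrBrDr.
- rewrite (_ : mkset _ = set0); first exact: open0.
  by apply/seteqP; split.
- rewrite (_ : mkset _ = setT); first exact: openT.
  by apply/seteqP; split=> // x _ /=; rewrite ltry.
Qed.

Lemma convex_rev_fenchel : convex_fun (rev_fenchel g).
Proof.
apply/convex_setP => -[x r] [x' r'] t t0 t1 /= /rev_conjugateP gx.
move=> /rev_conjugateP gx'; apply/rev_conjugateP => y.
move: (gx y) (gx' y); case: (g y) => [b||]//=; rewrite ?leNye//.
rewrite -!EFinB !lee_fin dotDl !dotZl => xr xr'.
have t1' : 0 <= 1 - t by rewrite subr_ge0.
have := lerD (ler_wpM2l t0 xr) (ler_wpM2l t1' xr').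
by apply: le_trans; rewrite le_eqVlt; apply/orP; left; apply/eqP; ring.
Qed.

Lemma closed_convex_rev_fenchel : closed_convex (rev_fenchel g).
Proof.
split; last exact: convex_rev_fenchel.
have [[x gx]|] := pselect (exists x, rev_fenchel g x = -oo%E); last first.
  move=> /forallNP gN; left; split=> //.
  exact: lower_semicontinuous_rev_fenchel.
(* A single value [-oo] forces [g] to be [+oo] everywhere, so the conjugate is constantly [-oo]. *)
right; apply/funext => x'; apply/eqP; rewrite -leeNy_eq.
apply/rev_conjugateP => y; have /rev_conjugateP/(_ y) : (rev_fenchel g x <= -oo)%E.
  by rewrite gx.
by case: (g y).
Qed.

End ClosedConvexConjugate.

(** * Projection onto a closed convex subset of R^d x R *)

Section Projection.
Context {R : realType} {d : nat}.
Implicit Types p q z : 'rV[R]_d * R^o.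

Definition pair_dot p q : R := dot p.1 q.1 + p.2 * q.2.

Lemma continuous_sqr_dist p :
  continuous (fun z => pair_dot (z - p) (z - p)).
Proof.
move=> z; have zp : (z - p) @[z --> z] --> z - p.
  by apply: cvgB; [exact: cvg_id|exact: cvg_cst].
apply: cvgD; first by apply: cvg_dot; apply: (cvg_comp _ _ zp); exact: cvg_fst.
by apply: cvgM; apply: (cvg_comp _ _ zp); exact: cvg_snd.
Qed.

Lemma nearest_point (C : set ('rV[R]_d * R^o)) p : closed C -> C !=set0 ->
  exists2 q, C q &
    forall z, C z -> pair_dot (q - p) (q - p) <= pair_dot (z - p) (z - p).
Proof.
move=> clC [z0 Cz0]; set phi := fun z => pair_dot (z - p) (z - p).
have phi_cont : continuous phi by exact: continuous_sqr_dist.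
pose M := phi z0; pose A := C `&` [set z | phi z <= M].
(* The radius [M + 1] avoids a square root: a square at most [M] has a root of absolute value at
   most [(M + 1) / 2]. *)
pose I (r : R) : set R := `[r - (M + 1), r + (M + 1)]%classic.
pose box := [set v : 'rV[R]_d | forall i, I (p.1 0 i) (v 0 i)] `*` I p.2.
have abs_le (r s : R) : (s - r) ^+ 2 <= M -> I r s.
  move=> srM; rewrite /I /= in_itv /=.
  have := sqr_ge0 (s - r - 1); have := sqr_ge0 (s - r + 1).
  by move=> ? ?; apply/andP; split; nra.
have coA : compact A.
  apply: (@subclosed_compact _ A box).
  - apply: closedI => //; apply: (@closed_comp _ _ phi [set r | r <= M]).
      by move=> z _; exact: phi_cont.
    exact: closed_le.
  - apply: compact_setX; last exact: segment_compact.
    by apply: (@rV_compact R d (fun i => I (p.1 0 i))) => i; exact: segment_compact.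
  - move=> [v r] [_ /=]; rewrite /phi /pair_dot /= => vrM; split=> /=.
      move=> i; apply: abs_le; have := sqr_coord_le_dot (v - p.1) i.
      rewrite !mxE; have := sqr_ge0 (r - p.2); rewrite expr2; lra.
    apply: abs_le; have := dot_ge0 (v - p.1); rewrite expr2; lra.
have [||q] := compact_EVT_min (f := phi) _ coA.
- by exists z0; split=> //=.
- exact: continuous_subspaceT.
rewrite inE => -[Cq qM] qmin; exists q => // z Cz.
have [zM|/ltW Mz] := leP (phi z) M; first by apply: qmin; rewrite inE.
exact: le_trans Mz.
Qed.

(** Were the product positive, a short move from the nearest point [q] towards [z] would stay in [C]
    and come closer to [p]. *)
Lemma convex_projection (C : set (convex_lmodType ('rV[R]_d * R^o)%type)) p :
  closed (C : set ('rV[R]_d * R^o)) -> convex_set C -> C !=set0 ->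
  exists2 q, C q & forall z, C z -> pair_dot (p - q) (z - q) <= 0.
Proof.
move=> clC /convex_setP cC C0.
have [q Cq qmin] := nearest_point p clC C0; exists q => // z Cz.
rewrite leNgt; apply/negP; set a := pair_dot _ _ => a0.
pose b := pair_dot (z - q) (z - q).
have b0 : 0 <= b by rewrite addr_ge0 ?dot_ge0// -expr2 sqr_ge0.
(* The squared distance changes by [t * (t * b - 2 * a)], negative since [t * b < a]. Unlike the
   minimizer [a / b], this [t] never exceeds 1 and allows [b = 0]. *)
pose t := a / (a + b).
have tab : t * (a + b) = a by rewrite divfK// gt_eqF// ltr_wpDr.
have t0 : 0 < t by rewrite divr_gt0// ltr_wpDr.
have t1 : t <= 1 by nra.
have := qmin _ (cC z q t (ltW t0) t1 Cz Cq).
have -> : pair_dot (t *: z + (1 - t) *: q - p) (t *: z + (1 - t) *: q - p) =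
    pair_dot (q - p) (q - p) - t * a *+ 2 + t ^+ 2 * b.
  rewrite /a /b /pair_dot /= -(opprB p.1 q.1) dotN.
  have -> : t *: z.1 + (1 - t) *: q.1 - p.1 = t *: (z.1 - q.1) - (p.1 - q.1).
    by apply/rowP => i; rewrite !mxE; ring.
  by rewrite sqr_dotZB /GRing.scale /=; ring.
nra.
Qed.

End Projection.

(** A point lies strictly below the graph when some real [a] separates its height from the value of
    [f], which exhibits the complement as a union of open products. *)
Lemma closed_epigraph (R : realType) (d : nat) (f : 'rV[R]_d -> \bar R) :
  lower_semicontinuous f -> closed (epigraph f : set ('rV[R]_d * R^o)).
Proof.
move=> /lower_semicontinuousP fa; rewrite -openC.
have -> : ~` (epigraph f : set ('rV[R]_d * R^o)) =
    \bigcup_a (fst @^-1` [set x | (a%:E < f x)%E] `&` snd @^-1` [set r | r < a]).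
  apply/seteqP; split=> -[x r] /=.
    move=> /negP; rewrite -ltNge.
    case fx : (f x) => [b||]//.
      rewrite lte_fin => /midf_lt[rm mb]; exists ((r + b) / 2) => //=.
      by rewrite fx lte_fin.
    by move=> _; exists (r + 1) => //=; rewrite fx ltry ltrDl.
  move=> [a _ [/= afx ra]]; apply/negP; rewrite -ltNge.
  by apply: lt_trans afx; rewrite lte_fin.
apply: bigcup_open => a _; apply: openI; apply: open_comp => //.
- by move=> z _; exact: cvg_fst.
- by move=> z _; exact: cvg_snd.
Qed.

(** * Affine minorants and the Fenchel-Moreau theorem *)

Section FenchelMoreau.
Context {R : realType} {d : nat} (f : 'rV[R]_d -> \bar R).
Hypotheses (f_lsc : lower_semicontinuous f) (f_conv : convex_fun f).
Hypothesis f_NNy : forall x, f x <> -oo%E.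

(** Equivalently, [b] bounds the Fenchel conjugate of [f] at [y] from above. *)
Definition affine_minorant (y : 'rV[R]_d) (b : R) :=
  forall z, ((dot z y - b)%:E <= f z)%E.

Lemma fineK_proper z : (f z < +oo)%E -> (fine (f z))%:E = f z.
Proof. by case: (f z) (@f_NNy z). Qed.

(** [(x1, s)] is the projection of [(x0, t)]. Epigraphs are closed upwards, so testing against
    [(x1, s + 1)] yields [t <= s]. *)
Lemma epigraph_projection x0 t z0 : (t%:E < f x0)%E -> (f z0 < +oo)%E ->
  exists x1 s, [/\ (f x1 <= s%:E)%E, t <= s &
    forall z r, (f z <= r%:E)%E ->
      dot (x0 - x1) (z - x1) + (t - s) * (r - s) <= 0].
Proof.
move=> tfx fz0.
have E0 : epigraph f !=set0.
  by exists (z0, fine (f z0)); rewrite /epigraph /= fineK_proper.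
have [[x1 s] /= fs proj] :=
  convex_projection ((x0, t) : 'rV[R]_d * R^o) (closed_epigraph f_lsc) f_conv E0.
exists x1, s; split=> //; last by move=> z r fz; exact: (proj (z, r)).
have fs1 : (f x1 <= (s + 1)%:E)%E by apply: le_trans fs _; rewrite lee_fin lerDl.
have := proj (x1, s + 1) fs1; rewrite /pair_dot /= subrr dot0r add0r.
by rewrite addrAC subrr add0r mulr1 subr_le0.
Qed.

(** Division by [s - t] turns the separating hyperplane through [(x1, s)] into the graph of an
    affine function, whose value at [x0] is [s] plus a nonnegative multiple of the squared norm of
    [x0 - x1]. *)
Lemma nonvertical_minorant x0 x1 t s : t < s ->
  (forall z r, (f z <= r%:E)%E ->
      dot (x0 - x1) (z - x1) + (t - s) * (r - s) <= 0) ->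
  exists y b, affine_minorant y b /\ t < dot x0 y - b.
Proof.
move=> ts proj; pose l := (s - t)^-1.
have l0 : 0 < l by rewrite invr_gt0 subr_gt0.
have lK : l * (s - t) = 1 by rewrite mulVf// subr_eq0 gt_eqF.
exists (l *: (x0 - x1)), (l * dot (x0 - x1) x1 - s).
have dotl z : dot z (l *: (x0 - x1)) = l * dot (x0 - x1) z.
  by rewrite dotC dotZl.
split.
  move=> z; rewrite dotl; case fz : (f z) => [r||]; rewrite ?leey//; last first.
    by have := f_NNy fz.
  have := proj z r; rewrite fz lexx => /(_ isT).
  rewrite (dotC _ (z - x1)) dotBl !(dotC _ (x0 - x1)) lee_fin => H.
  have lKr : l * (s - t) * (r - s) = r - s by rewrite lK mul1r.
  have := ler_wpM2l (ltW l0) H; lra.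
rewrite dotl.
have := mulr_ge0 (ltW l0) (dot_ge0 (x0 - x1)).
rewrite {1}dotBl !(dotC _ (x0 - x1)); lra.
Qed.

Lemma affine_minorant_above x0 t : (t%:E < f x0)%E ->
  exists y b, affine_minorant y b /\ t < dot x0 y - b.
Proof.
move=> tfx.
have [[z0 fz0]|fy] := pselect (exists z, (f z < +oo)%E); last first.
  (* Here [f] is constantly [+oo], and the constant [t + 1] is a minorant. *)
  exists 0, (- t - 1); split; last first.
    by rewrite dot0r; lra.
  move=> z; move/forallNP : fy => /(_ z).
    by case: (f z) => [r||]//=; rewrite ?leey// ltry.
have [x1 [s [fs ts proj]]] := epigraph_projection tfx fz0.
have [/nonvertical_minorant|st] := ltP t s; first by apply; exact: proj.
have {ts st} st : s = t by apply/eqP; rewrite eq_le ts st.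
subst s.
pose u := x0 - x1.
(* If [u] vanished, [(x0, t)] would lie in the epigraph. *)
have u0 : 0 < dot u u.
  rewrite lt_neqAle dot_ge0 andbT eq_sym; apply/eqP => /dot_eq0 /eqP.
  by rewrite subr_eq0 => /eqP x01; move: tfx; rewrite ltNge x01 fs.
(* The separating hyperplane is vertical here: a large multiple of it is added
   to some affine minorant, which exists because the hyperplane obtained from a
   point below (z0, f z0) is never vertical. *)
have [y [b [yb _]]] : exists y b,
    affine_minorant y b /\ fine (f z0) - 1 < dot z0 y - b.
  have fz0E := fineK_proper fz0.
  have t'fz0 : ((fine (f z0) - 1)%:E < f z0)%E by rewrite -fz0E lte_fin; lra.
  have [x' [s' [fs' ts' proj']]] := epigraph_projection t'fz0 fz0.
  have [/nonvertical_minorant|st'] := ltP (fine (f z0) - 1) s'.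
    by apply; exact: proj'.
  (* In the vertical case, testing against [(z0, f z0)] forces [x' = z0], whence the absurd
     [f z0 <= f z0 - 1]. *)
  have {ts' st'} st' : s' = fine (f z0) - 1 by apply/eqP; rewrite eq_le ts' st'.
  have := proj' z0 (fine (f z0)); rewrite fz0E lexx st' subrr mul0r addr0.
  move=> /(_ isT) le0; have /dot_eq0/eqP : dot (z0 - x') (z0 - x') = 0.
    by apply/eqP; rewrite eq_le dot_ge0 le0.
  rewrite subr_eq0 => /eqP zx'; move: fs'; rewrite -zx' st' -fz0E lee_fin; lra.
(* The added term [k * dot u (z - x1)] is nonpositive wherever [f] is finite; at [x0] it equals
   [k * dot u u], chosen to exceed the gap between [t] and the first minorant. *)
pose k := (`|t - (dot x0 y - b)| + 1) / dot u u.
have k0 : 0 <= k by rewrite divr_ge0 ?addr_ge0// ltW.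
have ku : k * dot u u = `|t - (dot x0 y - b)| + 1 by rewrite divfK// gt_eqF.
have doty z : dot z (y + k *: u) = dot z y + k * dot u z.
  by rewrite dotC dotDl dotZl (dotC y).
exists (y + k *: u), (b + k * dot u x1); split.
  move=> z; case fz : (f z) => [r||]; rewrite ?leey//; last by have := f_NNy fz.
  have := yb z; rewrite fz !lee_fin => ybz.
  have := proj z r; rewrite fz lexx subrr mul0r addr0 => /(_ isT).
  rewrite -/u dotC dotBl !(dotC _ u) => uz.
  have := ler_wpM2l k0 uz; rewrite doty; lra.
have uE : dot u u = dot u x0 - dot u x1.
  by rewrite {1}/u dotBl !(dotC _ u).
have := ler_norm (t - (dot x0 y - b)); rewrite doty; move: ku; rewrite uE; lra.
Qed.

End FenchelMoreau.

(** An affine minorant of slope [y] and offset [b] passing above [t] at [x] bounds the conjugate at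
    [y] by [b], so the biconjugate at [x] is at least [dot x y - b], hence at least [t]. *)
Lemma fenchel_moreau (R : realType) (d : nat) (f : 'rV[R]_d -> \bar R) x :
  closed_convex f -> (f x <= biconjugate (@dot R d) f x)%E.
Proof.
move=> [[[f_lsc f_NNy]|->] f_conv]; last by rewrite leNye.
apply: leeP_lt_fin => t tfx.
have [y [b [yb tb]]] := affine_minorant_above f_lsc f_conv f_NNy tfx.
apply: le_trans (rev_conjugate_ubound _ _ _ y).
have fyb : (conjugate (@dot R d) f y <= b%:E)%E.
  apply: conjugate_le => z; apply: lee_fin_subC.
  by rewrite -EFinB; exact: yb.
apply: (@le_trans _ _ (dot x y - b)%:E); first by rewrite lee_fin ltW.
by rewrite EFinB; exact: leeB.
Qed.

(** * The E-Capra coupling *)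

Section ECapra.
Context {R : realType} {d : nat}.

Lemma ecapraE (x y : 'rV[R]_d) : ecapra x y = dot (normalization x) y.
Proof.
rewrite /ecapra /normalization; case: eqP => _; last by rewrite dotZl mulrC.
by rewrite dotC dot0r.
Qed.

Lemma rev_conjugate_ecapra (g : 'rV[R]_d -> \bar R) :
  rev_conjugate (@ecapra R d) g = rev_fenchel g \o @normalization R d.
Proof.
apply/funext => x; rewrite /rev_fenchel /rev_conjugate /=.
by congr ereal_sup; apply: eq_imagel => y _; rewrite ecapraE.
Qed.

Lemma coupling_convex_comp_normalization (f : 'rV[R]_d -> \bar R) :
  closed_convex f -> coupling_convex (@ecapra R d) (f \o @normalization R d).
Proof.
move=> f_cc; apply/funext => x; apply/eqP.
rewrite eq_le biconjugate_le andbT /biconjugate rev_conjugate_ecapra /=.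
apply: le_trans (fenchel_moreau _ f_cc) _; apply: le_rev_conjugate => y.
(* The supremum in the E-Capra conjugate only tests [f] on the image of [normalization], so the
   Fenchel conjugate of [f] dominates it. *)
apply: conjugate_le => z; rewrite ecapraE; exact: conjugate_ubound.
Qed.

End ECapra.

Theorem proposition3p3 (R : realType) (d : nat) (d_ge1 : (1 <= d)%N) :
  (forall h : 'rV[R]_d -> \bar R,
     coupling_convex (@ecapra R d) h <->
     exists f : 'rV[R]_d -> \bar R,
       closed_convex f /\ h = f \o @normalization R d) /\
  (forall h : 'rV[R]_d -> \bar R,
     closed_convex (rev_fenchel (conjugate (@ecapra R d) h)) /\
     [<-> coupling_convex (@ecapra R d) h;
          h = rev_conjugate (@ecapra R d) (conjugate (@ecapra R d) h);
          h = rev_fenchel (conjugate (@ecapra R d) h) \o @normalization R d;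
          exists f : 'rV[R]_d -> \bar R,
            closed_convex f /\ h = f \o @normalization R d]).
Proof.
split=> h; split.
- move=> hE; exists (rev_fenchel (conjugate (@ecapra R d) h)); split.
    exact: closed_convex_rev_fenchel.
  by rewrite -rev_conjugate_ecapra.
- by move=> [f [f_cc ->]]; exact: coupling_convex_comp_normalization.
- exact: closed_convex_rev_fenchel.
- tfae.
  (* The first two statements agree by definition; the last implication closes the cycle. *)
  + by [].
  + by rewrite rev_conjugate_ecapra.
  + move=> hE; exists (rev_fenchel (conjugate (@ecapra R d) h)).
    by split=> //; exact: closed_convex_rev_fenchel.
  + by move=> [f [f_cc ->]]; exact: coupling_convex_comp_normalization.
Qed.
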